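(* Let $c\neq d$, let $N=\mathrm{iso}(\{c\},\{c,d\})$, let $M$ be an $N$-fragile matroid representable over a finite field $\mathbb{F}$ of order $q$, and let $C$ and $D$ be disjoint subsets of $E(M)$ such that $N= M/ C\setminus D$. Then $C\cup\{d\}$ is a circuit-hyperplane of $M$, and the matroid obtained from $M$ by relaxing $C\cup\{d\}$ is representable over the field of order $q^2$.
   Context: A matroid $M$ is $N$-fragile if $N$ is a minor of $M$ (meaning $N$ itself, on the ground set $E(N)\subseteq E(M)$, equals $M/C\setminus D$ for some partition $(C,D)$ of $E(M)-E(N)$), but there is no element $e\in E(M)$ such that $N$ is a minor of both $M\setminus e$ and $M/e$. $\mathrm{iso}(\{c\},\{c,d\})$ is the matroid on $\{c,d\}$ in which $c$ is a coloop and $d$ is a loop. Relaxing a circuit-hyperplane $H$ means forming the matroid whose bases are the original bases together with $H$. *)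

(* Defs.v *)
From mathcomp Require Import all_boot all_order all_algebra.

Set Implicit Arguments.
Unset Strict Implicit.
Unset Printing Implicit Defensive.

(* The axioms are boolean and the independent sets form a {set {set T}}, so   *)
(* two matroids are equal as soon as their ground sets and their families of  *)
(* independent sets are (matroid_eq).                                         *)
Definition matroid_axioms (T : finType) (E : {set T}) (I : {set {set T}}) :=
  [&& set0 \in I,
      [forall X in I, X \subset E],
      [forall X in I, forall Y : {set T}, (Y \subset X) ==> (Y \in I)] &
      [forall X in I, forall Y in I,
        (#|X| < #|Y|) ==> [exists e in Y :\: X, e |: X \in I]]].

Record matroid (T : finType) := Matroid {
  ground : {set T};
  indeps : {set {set T}};
  matroidP : matroid_axioms ground indeps }.

Section Notions.

Variables (T : finType) (M : matroid T).
Implicit Types X : {set T}.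

Definition bases : {set {set T}} :=
  [set B | maxset [pred X : {set T} | X \in indeps M] B].

Definition rank X : nat := \max_(I in indeps M | I \subset X) #|I|.

Definition mclosure X : {set T} :=
  [set e in ground M | rank (e |: X) == rank X].

Definition flat X := (X \subset ground M) && (mclosure X == X).

Definition circuit X :=
  minset [pred Y : {set T} | (Y \subset ground M) && (Y \notin indeps M)] X.

Definition hyperplane X := flat X && ((rank X).+1 == rank (ground M)).

Definition circuit_hyperplane X := circuit X && hyperplane X.

End Notions.

Section Basics.

Variables (T : finType).
Implicit Types (M : matroid T) (X Y I : {set T}).

Lemma matroid_eq M1 M2 :
  ground M1 = ground M2 -> indeps M1 = indeps M2 -> M1 = M2.
Proof.
case: M1 M2 => [E1 I1 P1] [E2 I2 P2] /= eqE eqI; subst.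
by congr Matroid; apply: bool_irrelevance.
Qed.

Lemma matroid_axiomsI (E : {set T}) (I : {set {set T}}) :
    set0 \in I -> (forall X, X \in I -> X \subset E) ->
    (forall X Y, X \in I -> Y \subset X -> Y \in I) ->
    (forall X Y, X \in I -> Y \in I -> #|X| < #|Y| ->
       exists2 e, e \in Y :\: X & e |: X \in I) ->
  matroid_axioms E I.
Proof.
move=> I0 IE Isub Iaug; apply/and4P; split=> //.
- by apply/forall_inP.
- apply/forall_inP=> X XI; apply/forallP=> Y; apply/implyP; exact: Isub.
- apply/forall_inP=> X XI; apply/forall_inP=> Y YI; apply/implyP=> lt_XY.
  by have [e eYX eXI] := Iaug _ _ XI YI lt_XY; apply/exists_inP; exists e.
Qed.

Lemma indep0 M : set0 \in indeps M.
Proof. by case/and4P: (matroidP M). Qed.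

Lemma indep_ground M X : X \in indeps M -> X \subset ground M.
Proof. by case/and4P: (matroidP M) => _ /forall_inP h _ _; apply: h. Qed.

Lemma indepS M X Y : X \in indeps M -> Y \subset X -> Y \in indeps M.
Proof.
case/and4P: (matroidP M) => _ _ /forall_inP h _ XI.
by move/forallP/(_ Y)/implyP: (h _ XI).
Qed.

Lemma indep_aug M X Y :
    X \in indeps M -> Y \in indeps M -> #|X| < #|Y| ->
  exists2 e, e \in Y :\: X & e |: X \in indeps M.
Proof.
case/and4P: (matroidP M) => _ _ _ /forall_inP h XI YI lt_XY.
by have /forall_inP/(_ _ YI)/implyP/(_ lt_XY)/exists_inP := h _ XI.
Qed.

Lemma leq_rank M X I : I \in indeps M -> I \subset X -> #|I| <= rank M X.
Proof.
by move=> II IX; apply: (@leq_bigmax_cond _ _ (fun I : {set T} => #|I|));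
  rewrite II IX.
Qed.

Lemma rank_witness M X :
  exists I, [/\ I \in indeps M, I \subset X & #|I| = rank M X].
Proof.
have [|I /andP[II IX] eqI] := @eq_bigmax_cond _
  [pred I : {set T} | (I \in indeps M) && (I \subset X)]
  (fun I : {set T} => #|I|).
  by apply/card_gt0P; exists set0; rewrite inE indep0 sub0set.
by exists I.
Qed.

Lemma basisP M B :
  reflect (B \in indeps M /\
           forall X, X \in indeps M -> B \subset X -> X = B)
          (B \in bases M).
Proof. by rewrite inE; apply: (iffP maxsetP). Qed.

Lemma sub_basis M X : X \in indeps M -> exists2 B, B \in bases M & X \subset B.
Proof.
move=> XI.
have [B mB XB] := @maxset_exists _ [pred Y : {set T} | Y \in indeps M] X XI.
by exists B; rewrite ?inE.
Qed.

End Basics.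

Section Operations.

Variables (T : finType).
Implicit Types (M N : matroid T) (X Y B C D E H I : {set T}).

Definition delete_indeps M D : {set {set T}} :=
  [set X in indeps M | X \subset ground M :\: D].

Fact delete_axioms M D :
  matroid_axioms (ground M :\: D) (delete_indeps M D).
Proof.
apply: matroid_axiomsI => [|X|X Y|X Y].
- by rewrite inE indep0 sub0set.
- by rewrite inE => /andP[].
- rewrite !inE => /andP[XI XE] YX.
  by rewrite (indepS XI YX) (subset_trans YX XE).
- rewrite !inE => /andP[XI XE] /andP[YI YE] lt_XY.
  have [e eYX eXI] := indep_aug XI YI lt_XY; exists e => //.
  rewrite inE eXI subUset XE sub1set andbT /=.
  by apply: (subsetP YE); move: eYX; rewrite inE => /andP[].
Qed.

Definition delete M D : matroid T := Matroid (delete_axioms M D).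

(* X is independent in M / C iff X :|: B is independent in M for some maximal *)
(* independent subset B of C.                                                 *)
Definition contract_indeps M C : {set {set T}} :=
  [set X : {set T} | (X \subset ground M :\: C) &&
    [exists B in bases (delete M (~: C)), X :|: B \in indeps M]].

Fact contract_axioms M C :
  matroid_axioms (ground M :\: C) (contract_indeps M C).
Proof.
have basC B : B \in bases (delete M (~: C)) -> B \in indeps M /\ B \subset C.
  case/basisP; rewrite !inE => /andP[BI BE] _; split=> //.
  by apply: subset_trans BE _; rewrite setDE setCK subsetIr.
have maxC B e : B \in bases (delete M (~: C)) -> e \in C ->
    e |: B \in indeps M -> e \in B.
  move=> Bb eC eBI; have [_ BC] := basC _ Bb.
  have /basisP[_ /(_ (e |: B)) <-] := Bb; last exact: subsetUr.
    by rewrite setU11.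
  by rewrite inE eBI /= setDE setCK subsetI (indep_ground eBI) subUset sub1set eC.
have leC B B' : B \in bases (delete M (~: C)) ->
    B' \in bases (delete M (~: C)) -> #|B'| <= #|B|.
  move=> Bb B'b; rewrite leqNgt; apply/negP => ltB.
  have [BI BC] := basC _ Bb; have [B'I B'C] := basC _ B'b.
  have [e] := indep_aug BI B'I ltB; rewrite inE => /andP[eB eB'] eBI.
  by case/negP: eB; apply: maxC (Bb) _ eBI; apply: (subsetP B'C).
have dis X (B : {set T}) : X \subset ground M :\: C -> B \subset C -> #|X :|: B| = #|X| + #|B|.
  move=> XE BC; rewrite cardsU; suff -> : X :&: B = set0 by rewrite cards0 subn0.
  apply/eqP; rewrite -subset0; apply/subsetP=> x; rewrite !inE => /andP[xX xB].
  by have := subsetP XE x xX; rewrite inE (subsetP BC x xB).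
apply: matroid_axiomsI => [|X|X Y|X Y].
- rewrite inE sub0set /=.
  have [B Bb _] := sub_basis (indep0 (delete M (~: C))).
  by apply/exists_inP; exists B; rewrite // set0U; case: (basC _ Bb).
- by rewrite inE => /andP[].
- rewrite !inE => /andP[XE /exists_inP[B Bb XBI]] YX.
  rewrite (subset_trans YX XE) /=; apply/exists_inP; exists B => //.
  by apply: indepS XBI _; apply: setSU.
- rewrite !inE => /andP[XE /exists_inP[B Bb XBI]] /andP[YE /exists_inP[B' B'b YBI]].
  move=> lt_XY; have [BI BC] := basC _ Bb; have [B'I B'C] := basC _ B'b.
  have [|e] := indep_aug XBI YBI.
    rewrite !dis //; apply: leq_trans (leq_add lt_XY (leqnn _)) _.
    by rewrite leq_add2l leC.
  rewrite !inE negb_or => /andP[/andP[eX eB] /orP[eY|eB']] eXB; last first.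
    case/negP: eB; apply: maxC Bb _ _; first exact: (subsetP B'C).
    by apply: indepS eXB _; apply: setUS; apply: subsetUr.
  exists e; first by rewrite inE eX.
  rewrite inE subUset sub1set (subsetP YE) //= XE /=.
  by apply/exists_inP; exists B; rewrite // -setUA.
Qed.

Definition contract M C : matroid T := Matroid (contract_axioms M C).

Definition is_minor N M : Prop :=
  exists C D : {set T},
    [/\ ground N \subset ground M, [disjoint C & D],
        C :|: D = ground M :\: ground N & N = delete (contract M C) D].

Definition fragile N M : Prop :=
  is_minor N M /\
  ~ (exists2 e, e \in ground M &
       is_minor N (delete M [set e]) /\ is_minor N (contract M [set e])).

Fact iso_axioms C E : matroid_axioms E (powerset (C :&: E)).
Proof.
apply: matroid_axiomsI => [|X|X Y|X Y].
- by rewrite powersetE sub0set.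
- by rewrite powersetE subsetI => /andP[].
- by rewrite !powersetE => XC YX; apply: subset_trans YX XC.
- rewrite !powersetE => XC YC lt_XY.
  have /subsetPn[e eY eX] : ~~ (Y \subset X).
    by apply/negP => /subset_leq_card; rewrite leqNgt lt_XY.
  exists e; first by rewrite inE eX.
  by rewrite powersetE subUset sub1set (subsetP YC).
Qed.

(* For C \subset E: every element of C is a coloop and every element of       *)
(* E :\: C is a loop.                                                         *)
Definition iso C E : matroid T := Matroid (iso_axioms C E).

(* The subsets of members of H |: bases M; bases_relax shows that the bases   *)
(* of the resulting matroid are exactly H |: bases M.                         *)
Definition relax_indeps M H : {set {set T}} :=
  [set X : {set T} | [exists B in H |: bases M, X \subset B]].

Lemma circuit_proper M H X :
  circuit M H -> X \proper H -> X \in indeps M.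
Proof.
case/minsetP=> /andP[HE _] Hmin XH; apply: contraT => XI.
have XsH := proper_sub XH.
by move: XH; rewrite (Hmin X) ?properxx //= XI (subset_trans XsH HE).
Qed.

Lemma relax_indepsE M H :
  circuit M H -> relax_indeps M H = H |: indeps M.
Proof.
move=> cH; apply/setP=> X; rewrite !inE; apply/exists_inP/orP.
- case=> B; rewrite in_setU1 => /orP[/eqP-> XH|/basisP[BI _] XB].
    have [->|neX] := eqVneq X H; [by left|right].
    by apply: circuit_proper cH _; rewrite properEneq neX.
  by right; apply: indepS BI XB.
- case=> [/eqP->|XI]; first by exists H; rewrite ?setU11.
  by have [B Bb XB] := sub_basis XI; exists B; rewrite // setU1r.
Qed.

Lemma circuit_hyperplane_card M H :
  circuit_hyperplane M H -> #|H| = rank M (ground M).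
Proof.
case/andP=> cH /andP[_ /eqP<-].
have /minsetP[/andP[_ HI] _] := cH.
have [e eH] : exists e, e \in H.
  by apply/set0Pn; apply: contraNneq HI => ->; apply: indep0.
rewrite (cardsD1 e) eH add1n; congr _.+1; apply/eqP; rewrite eqn_leq.
rewrite leq_rank ?subD1set ?(circuit_proper cH) ?properD1 //=.
have [I [II IH <-]] := rank_witness M H.
rewrite -ltnS; have <- : #|H| = #|H :\ e|.+1 by rewrite (cardsD1 e H) eH.
apply: proper_card; rewrite properEneq IH andbT.
by apply: contraNneq HI => <-.
Qed.

Fact relax_axioms M H :
  circuit_hyperplane M H -> matroid_axioms (ground M) (relax_indeps M H).
Proof.
move=> chH; have cardH := circuit_hyperplane_card chH.
have /andP[cH /andP[/andP[HE /eqP clH] /eqP rkH]] := chH.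
rewrite relax_indepsE //; apply: matroid_axiomsI => [|X|X Y|X Y].
- by rewrite setU1r ?indep0.
- by case/setU1P=> [->//|]; apply: indep_ground.
- case/setU1P=> [->|XI] YX; last by rewrite setU1r // (indepS XI).
  have [->|neY] := eqVneq Y H; first by rewrite setU11.
  by rewrite setU1r // (circuit_proper cH) // properEneq neY.
case/setU1P=> [->|XI] /setU1P[->|YI] lt_XY.
- by rewrite ltnn in lt_XY.
- by move: lt_XY; rewrite cardH ltnNge leq_rank // indep_ground.
- have [XH|/subsetPn[x xX xH]] := boolP (X \subset H).
    have /subsetPn[e eH eX] : ~~ (H \subset X).
      by apply/negP => /subset_leq_card; rewrite leqNgt lt_XY.
    exists e; first by rewrite inE eX.
    have [->|neX] := eqVneq (e |: X) H; first by rewrite setU11.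
    by rewrite setU1r // (circuit_proper cH) // properEneq neX subUset sub1set eH.
  have xE := subsetP (indep_ground XI) x xX.
  have ltrk : rank M H < rank M (x |: H).
    have : x \notin mclosure M H by rewrite clH.
    rewrite inE xE /= ltn_neqAle eq_sym => -> /=.
    have [I [II IH <-]] := rank_witness M H.
    by rewrite leq_rank // (subset_trans IH) // subsetUr.
  have [I [II IH eqI]] := rank_witness M (x |: H).
  have [|e] := indep_aug XI II.
    by apply: leq_trans lt_XY _; rewrite cardH -rkH eqI.
  rewrite inE => /andP[eX eI] eXI; exists e; last by rewrite setU1r.
  rewrite inE eX /=; case/setU1P: (subsetP IH e eI) => [ex|//].
  by rewrite ex xX in eX.
- have [e eYX eXI] := indep_aug XI YI lt_XY.
  by exists e; rewrite // setU1r.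
Qed.

Definition relax M H (chH : circuit_hyperplane M H) : matroid T :=
  Matroid (relax_axioms chH).

Lemma bases_relax M H (chH : circuit_hyperplane M H) :
  bases (relax chH) = H |: bases M.
Proof.
have /andP[cH _] := chH; have /minsetP[/andP[HE HnI] _] := cH.
have cardH := circuit_hyperplane_card chH.
have maxH X : X \in indeps M -> H \subset X -> X = H.
  by move=> XI /(indepS XI) HI; rewrite HI in HnI.
apply/setP=> B; apply/basisP/setU1P; rewrite /= relax_indepsE //.
- case=> /setU1P[->|BI] Bmax; [by left|right].
  by apply/basisP; split=> // X XI; apply: Bmax; rewrite setU1r.
- case=> [->|/basisP[BI Bmax]].
    by split=> [|X /setU1P[->//|]]; [rewrite setU11|apply: maxH].
  split=> [|X /setU1P[->|]]; [by rewrite setU1r| |exact: Bmax].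
  move=> BH; apply/eqP; rewrite eq_sym eqEcard BH cardH leqNgt /=; apply/negP.
  have [I [II _ <-]] := rank_witness M (ground M).
  case/(indep_aug BI II) => e; rewrite inE => /andP[eB _] eBI.
  by rewrite -(Bmax _ eBI (subsetUr _ _)) setU11 in eB.
Qed.

End Operations.

(* Each e : T labels a vector A e (the values of A off the ground set are     *)
(* irrelevant); repeated vectors make the sequence non-free.                  *)
Definition representable (T : finType) (F : fieldType) (M : matroid T) : Prop :=
  exists (k : nat) (A : T -> 'rV[F]_k),
    forall X : {set T}, X \subset ground M ->
      (X \in indeps M) = free [seq A e | e <- enum X].

(* Main.v *)
From HB Require Import structures.
From mathcomp Require Import all_boot all_order all_algebra.
From mathcomp Require Import all_fingroup all_solvable all_field.
Require Import Defs.

Set Implicit Arguments.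
Unset Strict Implicit.
Unset Printing Implicit Defensive.

Import GRing.Theory.

(** If [Z] avoids [c] and [d], then [N = M / Z \ D'] for the complementary [D']
    exactly when [d] lies in the closure of [Z] and [c] does not. Were this to
    hold for two sets [Z], an element of their symmetric difference would be
    both deletable and contractible; hence fragility says that [C] is the only
    such [Z]. Applied to [C - e] and [C + e], this makes [C + d] a
    circuit-hyperplane.

    If the vectors [A e] represent [M] over [F] and [t] lies in an extension
    field [K] but not in [F], then replacing [A d] by [A d + t A c] represents
    the relaxation. Indeed this vector lies in the [K]-span of the independent
    vectors [A Z] iff both [A d] and [A c] lie in their [F]-span. So a dependent
    set [Z + d] with [Z] independent becomes independent iff [d] but not [c] is
    in the closure of [Z], which by uniqueness means [Z = C]. *)

(** * Rank in matroids and their minors *)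

Section Rank.
Variable T : finType.
Implicit Types (M : matroid T) (X Y Z C D I : {set T}) (c d e : T).

Lemma rank_le_card M X : rank M X <= #|X|.
Proof.
by have [I [_ IX <-]] := rank_witness M X; apply: subset_leq_card.
Qed.

Lemma indepE M X : X \subset ground M -> (X \in indeps M) = (rank M X == #|X|).
Proof.
move=> XE; apply/idP/eqP=> [XI|rkX].
  by apply/eqP; rewrite eqn_leq rank_le_card leq_rank.
have [I [II IX cardI]] := rank_witness M X.
suff <- : I = X by [].
by apply/eqP; rewrite eqEcard IX cardI rkX /=.
Qed.

Lemma indep_extend M I X : I \in indeps M -> I \subset X ->
  exists J, [/\ J \in indeps M, I \subset J, J \subset X & #|J| = rank M X].
Proof.
move=> II IX.
have [|J] := @maxset_exists _ [pred Y | (Y \in indeps M) && (Y \subset X)] I.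
  by rewrite /= II.
case/maxsetP=> /andP[JI JX] Jmax IJ; exists J; split=> //.
apply/eqP; rewrite eqn_leq leq_rank //= leqNgt; apply/negP=> ltJ.
have [L [LI LX cardL]] := rank_witness M X.
have [|e] := indep_aug JI LI; first by rewrite cardL.
rewrite inE => /andP[eJ eL] eJI.
move: eJ; rewrite -(Jmax (e |: J)) ?setU11 ?subsetUr //=.
by rewrite eJI subUset sub1set (subsetP LX).
Qed.

Lemma rank_delete M D X : X \subset ground M :\: D ->
  rank (delete M D) X = rank M X.
Proof.
move=> XE; apply/eqP; rewrite eqn_leq; apply/andP; split.
  have [I [+ IX <-]] := rank_witness (delete M D) X.
  by rewrite inE => /andP[II _]; apply: leq_rank.
have [I [II IX <-]] := rank_witness M X.
by apply: leq_rank; rewrite // inE II (subset_trans IX).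
Qed.

Lemma card_basis_restr M C B : C \subset ground M ->
  B \in bases (delete M (~: C)) ->
  [/\ B \in indeps M, B \subset C & #|B| = rank M C].
Proof.
move=> CE /basisP[]; rewrite inE setDE setCK subsetI => /and3P[BI _ BC] Bmax.
split=> //; have [J [JI BJ JC <-]] := indep_extend BI BC.
congr #|pred_of_set _|; apply/esym/Bmax => //.
by rewrite inE JI setDE setCK subsetI (indep_ground JI).
Qed.

(** A basis of [C] extends to a basis [J] of [X :|: C], and [J :\: C] is then a basis of [X] in the
    contraction. The additive form avoids truncated subtraction. *)
Lemma rank_contract M C X : C \subset ground M -> X \subset ground M :\: C ->
  rank (contract M C) X + rank M C = rank M (X :|: C).
Proof.
move=> CE XE.
have XC Y (Z : {set T}) :
    Y \subset X -> Z \subset C -> #|Y :|: Z| = #|Y| + #|Z|.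
  move=> YX ZC; apply/eqP; rewrite (leq_card_setU Y Z).2.
  rewrite (disjointWl YX) // (disjointWr ZC) //.
  by move: XE; rewrite subsetD => /andP[].
apply/eqP; rewrite eqn_leq; apply/andP; split.
  have [I [+ IX <-]] := rank_witness (contract M C) X.
  rewrite inE => /andP[IE /exists_inP[B Bb IBI]].
  have [BI BC <-] := card_basis_restr CE Bb.
  by rewrite -XC // leq_rank // setUSS.
have [B [BI BC cardB]] := rank_witness M C.
have [J [JI BJ JX cardJ]] := indep_extend BI (subset_trans BC (subsetUr X C)).
have JCB : J :&: C = B.
  apply/esym/eqP; rewrite eqEcard subsetI BJ BC cardB /=.
  by apply: leq_rank; rewrite ?subsetIr // (indepS JI) ?subsetIl.
have JDX : J :\: C \subset X by rewrite subDset setUC.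
have JE : J = J :\: C :|: B by rewrite -JCB setUC setID.
rewrite -cardJ [in #|J|]JE XC // cardB leq_add2r; apply: leq_rank => //.
rewrite inE (subset_trans JDX) //=.
apply/exists_inP; exists B; last by rewrite -JE.
apply/basisP; split.
  by rewrite inE BI setDE setCK subsetI BC (indep_ground BI).
move=> Y; rewrite inE setDE setCK subsetI => /and3P[YI _ YC] BY.
by apply/esym/eqP; rewrite eqEcard BY cardB leq_rank.
Qed.

Lemma rankS M X Y : X \subset Y -> rank M X <= rank M Y.
Proof.
move=> XY; have [I [II IX <-]] := rank_witness M X.
by rewrite leq_rank // (subset_trans IX).
Qed.

Lemma rank_setU1 M e X : rank M (e |: X) <= (rank M X).+1.
Proof.
have [I [II IX <-]] := rank_witness M (e |: X).
rewrite (cardsD1 e I) -add1n leq_add ?leq_b1 // leq_rank //.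
  by rewrite (indepS II) ?subD1set.
by rewrite subDset.
Qed.

(** This is monotonicity of closure in rank form. If [e] raised the rank of [Y], a basis of [X]
    extended to one of [e |: Y] would contain [e], so [e] would raise the rank of [X] too. *)
Lemma rank_setU1S M e X Y : X \subset Y ->
  rank M (e |: X) = rank M X -> rank M (e |: Y) = rank M Y.
Proof.
move=> XY rkX; have [eY|eY] := boolP (e \in Y).
  by rewrite (setUidPr _) ?sub1set.
apply/eqP; rewrite eqn_leq (rankS M (subsetUr [set e] Y)) andbT leqNgt.
apply/negP=> ltY.
have [I [II IX cardI]] := rank_witness M X.
have [J [JI IJ JY cardJ]] := indep_extend II (subset_trans IX XY).
have [L [LI JL LY cardL]] :=
  indep_extend JI (subset_trans JY (subsetUr [set e] Y)).
have eL : e \in L.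
  apply: contraLR ltY => eL; rewrite -leqNgt -cardL leq_rank //.
  apply/subsetP=> x xL; case/setU1P: (subsetP LY x xL) => // xe.
  by rewrite -xe xL in eL.
have : #|e |: I| <= rank M (e |: X).
  rewrite leq_rank ?setUS // (indepS LI) // subUset sub1set eL.
  exact: subset_trans JL.
rewrite rkX -cardI cardsU1 (contra (subsetP (subset_trans IX XY) e)) //.
by rewrite ltnn.
Qed.

(** Otherwise a basis of [Y] could be augmented by some [e] in [X], and this [e] would raise the
    rank of [Y]. *)
Lemma rank_spanned M X Y :
  {in X, forall e, rank M (e |: Y) = rank M Y} -> rank M X <= rank M Y.
Proof.
move=> XY; rewrite leqNgt; apply/negP=> ltYX.
have [I [II IY cardI]] := rank_witness M Y.
have [J [JI JX cardJ]] := rank_witness M X.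
have [|e] := indep_aug II JI; first by rewrite cardI cardJ.
rewrite inE => /andP[eI /(subsetP JX)/XY rke] eII.
have : #|e |: I| <= rank M (e |: Y) by rewrite leq_rank // setUS.
by rewrite rke cardsU1 eI cardI ltnn.
Qed.

(** By [rank_contract], [X] is independent in the minor iff [rank M (X :|: C) = #|X| + rank M C].
    The two conditions are this test for [[set c]] and [[set d]], and heredity settles the other
    subsets of [[set c; d]]. *)
Lemma iso_minorE M c d C D : C \subset ground M ->
    ground M :\: C :\: D = [set c; d] -> c != d ->
  iso [set c] [set c; d] = delete (contract M C) D <->
  rank M (c |: C) = (rank M C).+1 /\ rank M (d |: C) = rank M C.
Proof.
move=> CE gE cd; set N := delete _ _.
have NE X : X \subset [set c; d] ->
    (X \in indeps N) = (rank M (X :|: C) == #|X| + rank M C).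
  move=> Xcd; have XE : X \subset ground M :\: C :\: D by rewrite gE.
  have XE' := subset_trans XE (subsetDl _ _).
  by rewrite indepE // rank_delete // -rank_contract // eqn_add2r.
have cS : [set c] \subset [set c; d] by rewrite sub1set set21.
have dS : [set d] \subset [set c; d] by rewrite sub1set set22.
split=> [defN | [rkc rkd]].
  split.
    apply/eqP; have := NE _ cS.
    by rewrite -defN cards1 inE subsetI subxx cS.
  have := NE _ dS; rewrite -defN cards1 inE subsetI.
  rewrite sub1set inE eq_sym (negPf cd) /=.
  move/esym/negbT=> rkd; apply/eqP.
  rewrite eqn_leq (rankS M (subsetUr [set d] C)) andbT.
  by rewrite -ltnS ltn_neqAle rkd rank_setU1.
apply: matroid_eq => /=; first by rewrite gE.
rewrite (setIidPl cS); apply/setP=> X; rewrite inE.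
apply/idP/idP=> [Xc | XI].
  by apply: (@indepS _ N [set c]) => //; rewrite NE // cards1 rkc.
have Xcd : X \subset [set c; d] by rewrite -gE; apply: (@indep_ground _ N).
apply/subsetP=> x xX.
have /set2P[->|xd] := subsetP Xcd x xX; first by rewrite inE.
have : [set d] \in indeps N by apply: (@indepS _ N X); rewrite // sub1set -xd.
by rewrite NE // cards1 rkd -[eqbLHS]add0n eqn_add2r.
Qed.

End Rank.

(** * Uniqueness of the contracted set *)

Section Fragile.
Variables (T : finType) (c d : T).
Hypothesis neq_cd : c != d.
Implicit Types (M : matroid T) (X Y Z C D I : {set T}).
Local Notation N := (iso [set c] [set c; d]).

(** Closure conditions are put as ranks because ranks pass to minors by [rank_delete] and
    [rank_contract]. *)
Definition separates M Z :=
  [/\ Z \subset ground M :\: [set c; d],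
      rank M (c |: Z) = (rank M Z).+1 & rank M (d |: Z) = rank M Z].

Lemma separates_minor M Z : [set c; d] \subset ground M ->
  separates M Z -> is_minor N M.
Proof.
move=> cdE [ZE rkc rkd].
have ZM : Z \subset ground M := subset_trans ZE (subsetDl _ _).
have Zcd : [disjoint [set c; d] & Z].
  by rewrite disjoint_sym; move: ZE; rewrite subsetD => /andP[].
exists Z, (ground M :\: [set c; d] :\: Z); split=> //=.
- by rewrite disjoint_sym disjoints_subset subsetDr.
- by rewrite -{1}(setIidPr ZE) setID.
apply/iso_minorE => //; apply/setP=> x; rewrite !in_setD.
have [xcd|_] := boolP (x \in [set c; d]).
  by rewrite (disjointFr Zcd xcd) (subsetP cdE).
by case: (x \in Z); case: (x \in ground M).
Qed.

Lemma separates_delete M Z e : e \notin Z -> e \notin [set c; d] ->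
  [set c; d] \subset ground M -> separates M Z ->
  separates (delete M [set e]) Z.
Proof.
move=> eZ ecd cdE [ZE rkc rkd].
have ZM : Z \subset ground M := subset_trans ZE (subsetDl _ _).
have sub X : X \subset ground M -> e \notin X -> X \subset ground M :\ e.
  by move=> XE eX; rewrite subsetD1 XE.
have [cE dE] : c \in ground M /\ d \in ground M.
  by move: cdE; rewrite subUset !sub1set => /andP[].
move: (ecd); rewrite !inE negb_or => /andP[ec ed].
split; first by rewrite subsetD /= sub //; move: ZE; rewrite subsetD => /andP[].
  by rewrite !rank_delete // sub // ?subUset ?sub1set ?cE // !inE negb_or ec.
by rewrite !rank_delete // sub // ?subUset ?sub1set ?dE // !inE negb_or ed.
Qed.

(** Contracting [e] lowers the ranks of [Z], [c |: Z] and [d |: Z] by the same amount [rank M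
    [set e]]. *)
Lemma separates_contract M Z e : e \in Z ->
  [set c; d] \subset ground M -> separates M Z ->
  separates (contract M [set e]) (Z :\ e).
Proof.
move=> eZ cdE [ZE rkc rkd].
have ZM : Z \subset ground M := subset_trans ZE (subsetDl _ _).
have eM : [set e] \subset ground M by rewrite sub1set (subsetP ZM).
have /setDP[_ ecd] := subsetP ZE e eZ.
move: (ecd); rewrite !inE negb_or => /andP[ec ed].
have [cE dE] : c \in ground M /\ d \in ground M.
  by move: cdE; rewrite subUset !sub1set => /andP[].
have ZeM : Z :\ e \subset ground M :\ e by rewrite setSD.
have defZ : Z :\ e :|: [set e] = Z by rewrite setUC setD1K.
have rkZ := rank_contract eM ZeM; rewrite defZ in rkZ.
have rk1 x : x \in ground M -> e != x ->
    rank (contract M [set e]) (x |: Z :\ e) + rank M [set e] = rank M (x |: Z).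
  move=> xM ex; rewrite rank_contract ?defZ -?setUA ?defZ //.
  by rewrite subUset ZeM andbT sub1set !inE eq_sym ex.
split; first by rewrite /= setDDl setUC -setDDl setSD.
  by apply/eqP; rewrite -(eqn_add2r (rank M [set e])) rk1 // rkc -rkZ addSn.
by apply/eqP; rewrite -(eqn_add2r (rank M [set e])) rk1 // rkd -rkZ.
Qed.

(** For [e] in [Y] but not in [Z], the set [Z] exhibits [N] as a minor of the deletion of [e], and
    [Y :\ e] as a minor of the contraction. *)
Lemma separates_sub M Y Z : fragile N M ->
  separates M Y -> separates M Z -> Y \subset Z.
Proof.
move=> [[C0 [D0 [cdE _ _ _]]] frag] sepY sepZ.
apply/subsetP=> e eY; apply: contraPT frag => eZ []; exists e.
  by case: sepY => YE _ _; have /setDP[] := subsetP YE e eY.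
have /setDP[eM ecd] : e \in ground M :\: [set c; d] by case: sepY => /subsetP->.
split.
  apply: (separates_minor _ (separates_delete eZ ecd cdE sepZ)).
  by rewrite subsetD1 cdE.
apply: (separates_minor _ (separates_contract eY cdE sepY)).
by rewrite subsetD1 cdE.
Qed.

Lemma separates_uniq M Y Z : fragile N M ->
  separates M Y -> separates M Z -> Y = Z.
Proof.
by move=> fragM sY sZ; apply/eqP; rewrite eqEsubset !(separates_sub fragM).
Qed.

(** * The circuit-hyperplane [d |: C] *)

Section CircuitHyperplane.

Variables (M : matroid T) (C : {set T}).
Hypotheses (fragM : fragile N M) (sepC : separates M C).

Let rkc : rank M (c |: C) = (rank M C).+1. Proof. by case: sepC. Qed.
Let rkd : rank M (d |: C) = rank M C. Proof. by case: sepC. Qed.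
Let CE : C \subset ground M :\: [set c; d]. Proof. by case: sepC. Qed.
Let CM : C \subset ground M. Proof. exact: subset_trans CE (subsetDl _ _). Qed.
Let cdM : [set c; d] \subset ground M.
Proof. by case: fragM => [[? [? []]]]. Qed.
Let dM : d \in ground M. Proof. by rewrite (subsetP cdM) ?set22. Qed.
Let dC : d \notin C.
Proof. by apply/negP => /(subsetP CE); rewrite !inE eqxx orbT. Qed.

(** [C :\ e] does not span [c], since [C] does not; if it spanned [d], it would be a second
    separating set. *)
Lemma fragile_rank_setD1 e : e \in C -> rank M (d |: C :\ e) != rank M (C :\ e).
Proof.
move=> eC; apply/eqP=> rk; suff sep : separates M (C :\ e).
  by move: eC; rewrite -(separates_uniq fragM sep sepC) !inE eqxx.
split=> //; first exact: subset_trans (subD1set C e) CE.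
apply/eqP; rewrite eqn_leq rank_setU1 ltn_neqAle rankS ?subsetUr // andbT.
apply/eqP=> /esym/(rank_setU1S (subD1set C e)).
by rewrite rkc => /eqP; rewrite eqn_leq ltnn.
Qed.

(** If a basis of [C] missed some [e] in [C], then [C :\ e] would have the rank of [C] and still
    span [d], against [fragile_rank_setD1]. *)
Lemma fragile_indep : C \in indeps M.
Proof.
have [I [II IC cardI]] := rank_witness M C.
suff <- : I = C by [].
apply/eqP; rewrite eqEsubset IC; apply/subsetP=> e eC; apply: contraT => eI.
case/eqP: (fragile_rank_setD1 eC); apply/eqP.
rewrite eqn_leq (rankS M (subsetUr [set d] _)) andbT.
apply: (@leq_trans (rank M (d |: C))).
  by rewrite rankS // setUS ?subD1set.
by rewrite rkd -cardI leq_rank // subsetD1 IC.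
Qed.

Lemma fragile_circuit : circuit M (d |: C).
Proof.
have HM : d |: C \subset ground M by rewrite subUset sub1set dM.
have indep_D1 e : e \in d |: C -> (d |: C) :\ e \in indeps M.
  have [-> _ | ed /setU1P[/eqP|eC]] := eqVneq e d.
  - by rewrite setU1K // fragile_indep.
  - by rewrite (negPf ed).
  have -> : (d |: C) :\ e = d |: C :\ e.
    rewrite setDUl; congr (_ :|: _); apply/setDidPl.
    by rewrite disjoints1 inE eq_sym.
  have CeI := indepS fragile_indep (subD1set C e).
  rewrite indepE ?subUset ?sub1set ?dM ?(indep_ground CeI) //.
  (* Adding [d] to [C :\ e] raises the rank by at most one, and by [fragile_rank_setD1] it does
     raise it. *)
  have := rank_setU1 M d (C :\ e); rewrite leq_eqVlt ltnS leq_eqVlt.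
  rewrite (negPf (fragile_rank_setD1 eC)) /= ltnNge.
  rewrite (rankS M (subsetUr _ _)) orbF.
  move/eqP->; rewrite cardsU1 !inE (negPf dC) andbF add1n eqSS.
  by rewrite -indepE // (indep_ground CeI).
apply/minsetP; split=> [|Y /andP[YM YI] YH].
  rewrite /= HM indepE // rkd cardsU1 dC add1n neq_ltn ltnS.
  by rewrite rank_le_card.
apply/eqP; rewrite eqEsubset YH; apply/subsetP=> e eH; apply: contraT => eY.
by case/negP: YI; apply: indepS (indep_D1 e eH) _; rewrite subsetD1 YH.
Qed.

(** For [e] other than [c], the set [e |: C] spans [d] because [C] does; if it did not span [c], it
    would be a second separating set. *)
Lemma fragile_rank_setU1 e : e \in ground M -> e \notin d |: C ->
  rank M (c |: (e |: C)) = rank M (e |: C).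
Proof.
rewrite inE negb_or in_set1 => eM /andP[ed eC].
have [->|ec] := eqVneq e c; first by rewrite setUA setUid.
apply/eqP; apply: contraT => rk; suff sep : separates M (e |: C).
  by case/negP: eC; rewrite -(separates_uniq fragM sep sepC) setU11.
split; first by rewrite subUset CE sub1set !inE negb_or ec ed eM.
- apply/eqP; rewrite eqn_leq rank_setU1 ltn_neqAle eq_sym rk.
  by rewrite (rankS M (subsetUr _ _)).
- exact: rank_setU1S (subsetUr _ _) rkd.
Qed.

Lemma fragile_hyperplane : hyperplane M (d |: C).
Proof.
have HM : d |: C \subset ground M by rewrite subUset sub1set dM.
apply/andP; split.
  rewrite /flat HM; apply/eqP/setP=> e; rewrite inE.
  apply/andP/idP=> [[eM /eqP rke] | eH]; last first.
    by rewrite (subsetP HM) // (setUidPr _) ?sub1set.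
  (* Such an [e] outside [d |: C] would leave [e |: C] with the rank of [C]; as [e |: C] spans [c],
     so would [C]. *)
  apply: contraT => eH; have : rank M (c |: C) <= rank M (e |: C).
    by rewrite -(fragile_rank_setU1 eM eH) rankS // setUS // subsetUr.
  have : rank M (e |: C) <= rank M C.
    by rewrite -rkd -rke rankS // setUS // subsetUr.
  by rewrite rkc => leC /leq_trans/(_ leC); rewrite ltnn.
rewrite rkd -rkc eqn_leq rankS /=; last first.
  by rewrite subUset CM andbT sub1set (subsetP cdM) ?set21.
(* It remains that [c |: C] spans [M]. For [e] off [d |: C], the rank of [c |: (e |: C)] is that of
   [e |: C], hence at most [(rank M C).+1], the rank of [c |: C]. *)
apply: rank_spanned => e eM; have [/setU1P[->|eC]|eH] := boolP (e \in d |: C).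
- exact: rank_setU1S (subsetUr _ _) rkd.
- by rewrite (setUidPr _) // sub1set inE eC orbT.
apply/eqP; rewrite eqn_leq (rankS M (subsetUr [set e] _)) andbT.
by rewrite setUCA fragile_rank_setU1 // rkc rank_setU1.
Qed.

End CircuitHyperplane.

End Fragile.

(** * Spans under field extension, and embeddings of finite fields *)

Local Open Scope ring_scope.

(** Turns spans into row spaces, whose behaviour under extension of scalars is given by [map_submx]
    and [map_cokermx]. *)
Lemma mem_span_submx (F : fieldType) k n (s : n.-tuple 'rV[F]_k) u :
  (u \in <<s>>%VS) = (u <= \matrix_(i < n) s`_i)%MS.
Proof.
apply/idP/submxP=> [/coord_span-> | [x ->]].
  exists (\row_i coord s i u); rewrite mulmx_sum_row.
  by apply: eq_bigr => i _; rewrite mxE rowK.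
rewrite mulmx_sum_row memv_suml // => i _.
by rewrite rowK memvZ // memv_span // mem_nth // size_tuple.
Qed.

Section Extension.

Variables (F K : fieldType) (f : {rmorphism F -> K}) (k : nat).
Implicit Types (u v : 'rV[F]_k) (s : seq 'rV[F]_k).

Lemma mem_span_map_submx n (s : n.-tuple 'rV[F]_k) w :
  (w \in <<map (map_mx f) s>>%VS) = (w <= map_mx f (\matrix_(i < n) s`_i))%MS.
Proof.
rewrite -[map _ _]/(tval (map_tuple (map_mx f) s)) mem_span_submx.
congr (_ <= _)%MS; apply/row_matrixP=> i; rewrite -map_row !rowK /=.
by rewrite (nth_map 0) // size_tuple.
Qed.

Lemma mem_span_map u s :
  (map_mx f u \in <<map (map_mx f) s>>%VS) = (u \in <<s>>%VS).
Proof.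
by rewrite (mem_span_map_submx (in_tuple s)) map_submx -mem_span_submx.
Qed.

Lemma free_map s : free (map (map_mx f) s) = free s.
Proof.
elim: s => [|u s IHs]; first by rewrite !nil_free.
by rewrite /= !free_cons IHs mem_span_map.
Qed.

(** A vector lies in the row space of [S] iff the cokernel matrix of [S], which is defined over [F],
    kills it. With [p] and [q] the images of [u] and [v] under that matrix, a nonzero entry of [q]
    would make [t] the image under [f] of a quotient; so [q] vanishes, and then [p]. *)
Lemma mem_span_map_add t u v s : (forall x, f x != t) ->
  (map_mx f u + t *: map_mx f v \in <<map (map_mx f) s>>%VS)
    = (u \in <<s>>%VS) && (v \in <<s>>%VS).
Proof.
move=> tF; rewrite (mem_span_map_submx (in_tuple s)).
rewrite -[s in RHS]/(tval (in_tuple s)) !mem_span_submx; set S := \matrix_i _.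
rewrite !submxE -map_cokermx mulmxDl -scalemxAl -!map_mxM.
move: (u *m _) (v *m _) => p q.
apply/eqP/andP=> [/rowP pq0 | [/eqP-> /eqP->]]; last first.
  by rewrite !map_mx0 scaler0 addr0.
have q0 : q = 0.
  apply/rowP=> j; have /eqP := pq0 j; rewrite !mxE addrC addr_eq0 => /eqP pq.
  apply: contraTeq isT => qj; case/eqP: (tF (- p ord0 j / q ord0 j)).
  by rewrite fmorph_div rmorphN -pq mulfK // fmorph_eq0.
split; last by rewrite q0.
apply/eqP/rowP=> j; have /eqP := pq0 j.
by rewrite q0 !mxE rmorph0 mulr0 addr0 fmorph_eq0 => /eqP.
Qed.

End Extension.

(* The minimal polynomial over the prime field of a generator [a] of the units
   of [F] divides ['X^#|K| - 'X], so it has a root [b] in [K]; the embedding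
   sends [h(a)] to [h(b)] for every polynomial [h] over the prime field. *)
Lemma finField_embedding (F K : finFieldType) (n : nat) :
  #|K| = (#|F| ^ n)%N -> inhabited {rmorphism F -> K}.
Proof.
move=> cardK; have [p pr_p pF] := finPcharP F.
pose F' := pPrimeCharType pF.
have pK : p \in [pchar K].
  apply: card_finPcharP pr_p.
  by rewrite cardK (card_pprimeChar pF) -expnM.
pose K' := pPrimeCharType pK.
have [a a_gen] : exists a : F', forall x, x != 0 -> exists i, x = a ^+ i.
  have /cyclicP[u gen_u] := field_unit_group_cyclic [group of [set: {unit F}]].
  exists (val u) => x nzx.
  have : finField_unit nzx \in <[u]>%g by rewrite -gen_u inE.
  case/cycleP=> i /(congr1 val).
  by rewrite FinRing.val_unitX /= => ->; exists i.
have /polyOver1P[m def_m] := minPolyOver 1 a.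
have dvd_m (h : {poly 'F_p}) : horner_alg a h = 0 -> m %| h.
  move=> ha0.
  rewrite -(dvdp_map (in_alg F')) -def_m minPoly_dvdp ?alg_polyOver //.
  exact/rootP.
have [b mb0] : exists b : K', horner_alg b m = 0.
  have : map_poly (in_alg K') m %| \prod_(x : K) ('X - x%:P).
    rewrite -finField_genPoly cardK.
    have -> : 'X^(#|F| ^ n) - 'X = map_poly (in_alg K') ('X^(#|F| ^ n) - 'X).
      by rewrite rmorphB rmorphXn /= map_polyX.
    rewrite dvdp_map; apply: dvd_m.
    rewrite rmorphB rmorphXn /= horner_algX.
    suff -> : a ^+ (#|F| ^ n) = a by rewrite subrr.
    by elim: n {cardK} => //= k IH; rewrite expnS exprM [a ^+ _]expf_card.
  rewrite -big_enum => /dvdp_prod_XsubC[s].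
  (* An empty mask would make [m] constant, but a minimal polynomial has positive degree. *)
  case: (mask s _) => [|x r] eqm.
    have /eqP := eqp_size eqm; rewrite big_nil size_poly1 size_map_poly.
    by rewrite -(size_map_poly (in_alg F')) -def_m size_minPoly.
  exists x; apply/eqP; rewrite -[_ == 0]/(root (map_poly (in_alg K') m) x).
  by rewrite (eqp_root eqm) root_prod_XsubC mem_head.
have kill (h : {poly 'F_p}) : horner_alg a h = 0 -> horner_alg b h = 0.
  by case/dvd_m/dvdpP => r ->; rewrite rmorphM /= mb0 mulr0.
have agree (h k : {poly 'F_p}) : horner_alg a h = horner_alg a k ->
    horner_alg b h = horner_alg b k.
  move=> hk; have /kill : horner_alg a (h - k) = 0.
    by rewrite rmorphB /= hk subrr.
  by rewrite rmorphB /= => /subr0_eq.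
have surj x : exists h : {poly 'F_p}, horner_alg a h == x.
  have [->|/a_gen[i ->]] := eqVneq x 0; first by exists 0; rewrite rmorph0.
  by exists 'X^i; rewrite rmorphXn /= horner_algX.
(* The polynomial [lift x] is an arbitrary choice; by [agree] its value at [b] does not depend on
   it, so [f] inherits the ring laws from evaluation at [b]. *)
pose lift x := xchoose (surj x).
have liftE x : horner_alg a (lift x) = x by exact/eqP/(xchooseP (surj x)).
pose f (x : F) : K := horner_alg b (lift x).
have fB : zmod_morphism f.
  move=> x y; apply: etrans (rmorphB (horner_alg b) _ _); apply: agree.
  by rewrite rmorphB /= !liftE.
have fM : monoid_morphism f.
  split=> [|x y].
    apply: etrans (rmorph1 (horner_alg b)); apply: agree.
    by rewrite rmorph1 liftE.
  apply: etrans (rmorphM (horner_alg b) _ _); apply: agree.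
  by rewrite rmorphM /= !liftE.
pose fA := GRing.isZmodMorphism.Build _ _ f fB.
pose fR := GRing.isMonoidMorphism.Build _ _ f fM.
pose fm : {rmorphism F -> K} := HB.pack f fA fR.
exact: (inhabits fm).
Qed.

(** * Representing the relaxation *)

Section Relaxation.

Variables (T : finType) (F : fieldType) (k : nat) (A : T -> 'rV[F]_k).
Variable M : matroid T.
Hypothesis repA : forall X : {set T}, X \subset ground M ->
  (X \in indeps M) = free [seq A e | e <- enum X].

Implicit Types (e : T) (Z : {set T}).

Lemma free_setU1 (K : fieldType) (B : T -> 'rV[K]_k) e Z :
    e \notin Z ->
  free [seq B x | x <- enum (e |: Z)] =
    (B e \notin <<[seq B x | x <- enum Z]>>%VS) && free [seq B x | x <- enum Z].
Proof.
move=> eZ; rewrite -free_cons -map_cons; apply/perm_free/perm_map.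
apply: uniq_perm; rewrite /= ?enum_uniq ?mem_enum ?eZ // => x.
by rewrite mem_enum !inE mem_enum.
Qed.

Lemma indep_setU1 e Z : e \in ground M -> e \notin Z -> Z \in indeps M ->
  (e |: Z \in indeps M) = (A e \notin <<[seq A x | x <- enum Z]>>%VS).
Proof.
move=> eM eZ ZI; have ZM := indep_ground ZI.
by rewrite repA ?subUset ?sub1set ?eM // free_setU1 // -repA // ZI andbT.
Qed.

(** Puts span membership into the rank form used by [separates]. *)
Lemma notin_span_rank e Z : e \in ground M -> Z \in indeps M ->
  (A e \notin <<[seq A x | x <- enum Z]>>%VS) =
    (rank M (e |: Z) == (rank M Z).+1).
Proof.
move=> eM ZI; have ZM := indep_ground ZI.
have [eZ|eZ] := boolP (e \in Z).
  rewrite (setUidPr _) ?sub1set // eqn_leq ltnn andbF; apply/negbTE.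
  by rewrite negbK memv_span // map_f // mem_enum.
rewrite -indep_setU1 // indepE ?subUset ?sub1set ?eM //.
have /eqP-> : rank M Z == #|Z| by rewrite -indepE.
by rewrite cardsU1 eZ.
Qed.

Lemma mem_span_rank e Z : e \in ground M -> Z \in indeps M ->
  A e \in <<[seq A x | x <- enum Z]>>%VS -> rank M (e |: Z) = rank M Z.
Proof.
move=> eM ZI Ae; have := rank_setU1 M e Z; rewrite leq_eqVlt.
rewrite -notin_span_rank // Ae /= ltnS => rk.
by apply/eqP; rewrite eqn_leq rk (rankS M (subsetUr [set e] Z)).
Qed.

Variables (c d : T) (C : {set T}).
Hypotheses (neq_cd : c != d) (fragM : fragile (iso [set c] [set c; d]) M).
Hypothesis sepC : separates c d M C.
Variable hH : circuit_hyperplane M (C :|: [set d]).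
Variables (K : fieldType) (f : {rmorphism F -> K}) (t : K).
Hypothesis tF : forall x, f x != t.

Lemma representable_relax : representable K (relax hH).
Proof.
have cdM : [set c; d] \subset ground M by case: fragM => [[? [? []]]].
have cM : c \in ground M by rewrite (subsetP cdM) ?set21.
have dM : d \in ground M by rewrite (subsetP cdM) ?set22.
have CI := fragile_indep neq_cd fragM sepC.
have [CE rkc rkd] := sepC.
have dC : d \notin C by apply/negP => /(subsetP CE); rewrite !inE eqxx orbT.
(* Only the vector of [d] is perturbed, so sets avoiding [d], none of which is the relaxed set, keep
   their dependences. *)
pose B e := map_mx f (A e) + (if e == d then t *: map_mx f (A c) else 0).
have BE (Z : {set T}) : d \notin Z ->
    [seq B x | x <- enum Z] = map (map_mx f) [seq A x | x <- enum Z].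
  move=> dZ; rewrite -map_comp; apply/eq_in_map=> x; rewrite mem_enum => xZ /=.
  by rewrite /B ifN ?addr0 //; apply: contraNneq dZ => <-.
exists k, B => X XM; rewrite /= relax_indepsE; last by case/andP: hH.
rewrite in_setU1; have [dX|dX] := boolP (d \in X); last first.
  rewrite BE // free_map -repA // [X == _]negbTE //.
  by apply: contraNneq dX => ->; rewrite !inE eqxx orbT.
rewrite -(setD1K dX); set Z := X :\ d.
have dZ : d \notin Z by rewrite !inE eqxx.
have ZM : Z \subset ground M by apply: subset_trans XM; apply: subD1set.
rewrite free_setU1 // BE // free_map -repA // {1}/B eqxx mem_span_map_add //.
have -> : (d |: Z == C :|: [set d]) = (Z == C).
  rewrite setUC; apply/eqP/eqP=> [ZC|->//].
  by rewrite -(setU1K dZ) setUC ZC setUC setU1K.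
have [ZI|ZI] := boolP (Z \in indeps M); last first.
  rewrite andbF; apply/negbTE; rewrite negb_or; apply/andP; split.
    by apply: contraNneq ZI => ->.
  by apply: contra ZI => /indepS-> //; apply: subsetUr.
rewrite andbT indep_setU1 // negb_and.
(* If [A d] is outside the span, [d |: Z] is already independent in [M] and both sides hold.
   Otherwise the claim is that [Z] is [C] iff [A c] is outside the span. *)
have [Ad|_] := boolP (A d \in _); last by rewrite orbT.
rewrite orbF notin_span_rank //=; apply/eqP/eqP=> [->//|rkcZ].
apply: (separates_uniq neq_cd fragM _ sepC); split=> //;
  last exact: mem_span_rank.
(* [Z] cannot contain [c], since adding [c] raises its rank. *)
rewrite subsetD ZM disjoint_sym disjoints_subset subUset !sub1set !in_setC dZ.
rewrite andbT; apply/negP=> cZ; move: rkcZ; rewrite (setUidPr _) ?sub1set //.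
by move/eqP; rewrite eqn_leq ltnn andbF.
Qed.

End Relaxation.

Local Close Scope ring_scope.

Theorem theorem1p6 (T : finType) (c d : T) (hcd : c <> d)
    (F : finFieldType) (q : nat) (hq : #|F| = q)
    (M : matroid T)
    (hfragile : fragile (iso [set c] [set c; d]) M)
    (hrep : representable F M)
    (C D : {set T})
    (hC : C \subset ground M) (hD : D \subset ground M)
    (hCD : [disjoint C & D])
    (hN : iso [set c] [set c; d] = delete (contract M C) D) :
  exists hH : circuit_hyperplane M (C :|: [set d]),
    forall K : finFieldType, #|K| = (q ^ 2)%N -> representable K (relax hH).
Proof.
have neq_cd : c != d by apply/eqP.
have gN : ground M :\: C :\: D = [set c; d].
  by rewrite -[RHS]/(ground (iso [set c] [set c; d])) hN.
have sepC : separates c d M C.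
  have [rkc rkd] := (iso_minorE hC gN neq_cd).1 hN; split=> //.
  rewrite subsetD hC -gN disjoint_sym disjoints_subset.
  by apply: subset_trans (subsetDl _ _) (subsetDr _ _).
have hH : circuit_hyperplane M (C :|: [set d]).
  rewrite setUC /circuit_hyperplane (fragile_circuit neq_cd hfragile sepC).
  exact: fragile_hyperplane hfragile sepC.
exists hH => K cardK; have [k [A repA]] := hrep.
have [f] : inhabited {rmorphism F -> K}.
  by apply: (@finField_embedding _ _ 2); rewrite hq.
(* If [f] were onto, [q ^ 2] would be at most [q], but [q] exceeds 1. *)
have [t tF] : exists t, t \notin codom f.
  apply/existsP; rewrite -negb_forall; apply/negP=> /forallP codf.
  have : (#|K| <= #|F|)%N.
    rewrite -(card_codom (fmorph_inj f)) subset_leq_card //.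
    exact/subsetP.
  by rewrite cardK hq leqNgt -{1}[q]expn1 ltn_exp2l // -hq finNzRing_gt1.
have {}tF x : f x != t by apply: contraNneq tF => <-; apply: codom_f.
exact: (representable_relax repA neq_cd hfragile sepC hH tF).
Qed.
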